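(* Let $K\ge1$, $\Delta_0,B>0$, and for $k=1,\dots,K$ let $m_k\ge0$, $v_k\ge0$. Let $\mathcal{G}\subset\mathbb{R}^K$ be the set of $\mathbf{r}$ for which there exist $\mathbf{p},\mathbf{y}\in\mathbb{R}^K$ and a $2K\times2K$ real matrix $\mathbf{H}=\begin{bmatrix}\mathbf{H}^{xx}&\mathbf{H}^{x\phi}\\(\mathbf{H}^{x\phi})^{\rm T}&\mathbf{H}^{\phi\phi}\end{bmatrix}$ satisfying, for every $k$: $r_k\ge0$; $r_k\le\Delta_0B\,p_k\log_2(1+y_k/p_k)$; $0\le p_k\le1$; $\sum_kp_k\le1$; $H^{x\phi}_{k,k}=y_k-p_km_k$; $H^{\phi\phi}_{k,k}=v_k$ and $H^{\phi\phi}_{i,j}=0$ for $i\neq j$; $H^{xx}_{k,k}\le p_k-p_k^2$; $\sum_{i,j}H^{xx}_{i,j}\le\sum_ip_i-(\sum_ip_i)^2$; $\mathbf{H}\succeq0$. Let $f(\mathbf{r})=\sum_k\ln r_k$ and $\mathbf{r}^*=\arg\max_{\mathbf{r}\in\mathcal{G}}f(\mathbf{r})$. Consider the iteration: $\mathbf{w}^{(1)}=[1/\sqrt K,\dots,1/\sqrt K]^{\rm T}$; for $i=1,2,\dots$, $\mathbf{r}^{(i)}=\arg\max_{\mathbf{r}\in\mathcal{G}}\langle\mathbf{w}^{(i)},\mathbf{r}\rangle$, $a^{(i)}=\|\mathbf{r}^*-\mathbf{r}^{(i)}\|_2^2/\langle\mathbf{w}^{(i)},\mathbf{r}^{(i)}-\mathbf{r}^*\rangle$,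 $b^{(i)}=-\min_k (r^*_k-r^{(i)}_k)/w^{(i)}_k$, $\mathbf{u}^{(i)}=(a^{(i)}+b^{(i)})\mathbf{w}^{(i)}+(\mathbf{r}^*-\mathbf{r}^{(i)})$, $\mathbf{w}^{(i+1)}=\mathbf{u}^{(i)}/\|\mathbf{u}^{(i)}\|_2$ (Algorithm 1, which stops at the first $i$ with $|\langle\mathbf{w}^{(i)},\mathbf{r}^{(i)}-\mathbf{r}^*\rangle|<\hat\epsilon$ for a given tolerance $\hat\epsilon>0$). Then the algorithm converges: $|\langle\mathbf{w}^{(i)},\mathbf{r}^{(i)}-\mathbf{r}^*\rangle|$ converges to $0$ as $i$ increases, i.e., for any $\hat\epsilon>0$, after a finite number of iterations $|\langle\mathbf{w}^{(i)},\mathbf{r}^{(i)}-\mathbf{r}^*\rangle|<\hat\epsilon$.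
   Context: $\langle\cdot,\cdot\rangle$ is the Euclidean inner product; $\mathbf{H}\succeq0$ means positive semidefinite; $p\log_2(1+y/p)$ is understood as its perspective (value $0$ at $p=0$). Convergence of the algorithm is defined in the paper as: for any positive $\hat\epsilon$, the quantity $|\langle\mathbf{w}^{(i)},\mathbf{r}^{(i)}-\mathbf{r}^*\rangle|$ is less than $\hat\epsilon$ after a number of iterations. *)

(* Defs.v *)
From HB Require Import structures.
From mathcomp Require Import all_boot all_order all_algebra.
From mathcomp Require Import reals exp.
Set Implicit Arguments. Unset Strict Implicit. Unset Printing Implicit Defensive.
Import Order.TTheory GRing.Theory Num.Theory.
Local Open Scope ring_scope.

Section Defs.
Variables (R : realType) (K : nat).

Definition dotv (a b : 'I_K -> R) : R := \sum_(k < K) a k * b k.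
Definition norm2 (a : 'I_K -> R) : R := Num.sqrt (\sum_(k < K) a k ^+ 2).
Definition vsub (a b : 'I_K -> R) : 'I_K -> R := fun k => a k - b k.

(* minimum over k (K >= 1): fold of Num.min starting at some entry *)
Definition vmin (a : 'I_K -> R) : R :=
  \big[Num.min/head 0 [seq a k | k <- enum 'I_K]]_(k < K) a k.

Definition log2 (x : R) : R := ln x / ln 2.

(* r <= D0 * B * (p log2(1 + y/p)), the perspective taking value 0 at p = 0;
   for p > 0 the logarithm must be defined, i.e. 1 + y/p > 0 *)
Definition rate_ok (D0 B p y r : R) : Prop :=
  (p = 0 -> r <= 0) /\
  (p <> 0 -> 0 < 1 + y / p /\ r <= D0 * B * (p * log2 (1 + y / p))).

Definition psd n (H : 'M[R]_n) : Prop :=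
  H^T = H /\ forall x : 'cV[R]_n, 0 <= (x^T *m H *m x) 0 0.

Definition inG (D0 B : R) (m v : 'I_K -> R) (r : 'I_K -> R) : Prop :=
  exists (p y : 'I_K -> R) (Hxx Hxp Hpp : 'M[R]_K),
    (forall k, 0 <= r k /\ rate_ok D0 B (p k) (y k) (r k) /\ 0 <= p k <= 1) /\
    \sum_(k < K) p k <= 1 /\
    (forall k, Hxp k k = y k - p k * m k) /\
    (forall i j, Hpp i j = (if i == j then v i else 0)) /\
    (forall k, Hxx k k <= p k - p k ^+ 2) /\
    \sum_(i < K) \sum_(j < K) Hxx i j
      <= \sum_(k < K) p k - (\sum_(k < K) p k) ^+ 2 /\
    psd (block_mx Hxx Hxp Hxp^T Hpp).

(* f(r) = sum_k ln r_k, with f = -oo unless all r_k > 0 *)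
Definition f_obj (r : 'I_K -> R) : R := \sum_(k < K) ln (r k).

Definition is_argmax_f (G : ('I_K -> R) -> Prop) (rs : 'I_K -> R) : Prop :=
  [/\ G rs, (forall k, 0 < rs k) &
      forall r, G r -> (forall k, 0 < r k) -> f_obj r <= f_obj rs].

Definition is_argmax_lin (G : ('I_K -> R) -> Prop) (w rr : 'I_K -> R) : Prop :=
  G rr /\ forall r, G r -> dotv w r <= dotv w rr.

Definition w_init : 'I_K -> R := fun _ => 1 / Num.sqrt (K%:R).

Definition w_next (w ri rs : 'I_K -> R) : 'I_K -> R :=
  let a := norm2 (vsub rs ri) ^+ 2 / dotv w (vsub ri rs) in
  let b := - vmin (fun k => (rs k - ri k) / w k) in
  let u := fun k => (a + b) * w k + (rs k - ri k) in
  fun k => u k / norm2 u.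

End Defs.

(* Main.v *)
Require Import Defs.
From HB Require Import structures.
From mathcomp Require Import all_boot all_order all_algebra.
From mathcomp Require Import boolp classical_sets reals topology normedtype exp.
From mathcomp Require Import ring lra.
Import Order.TTheory GRing.Theory Num.Theory.
Import numFieldNormedType.Exports.
Local Open Scope ring_scope.

Set Implicit Arguments. Unset Strict Implicit. Unset Printing Implicit Defensive.

(* Write d = r_i - rs.  Each iteration is a normalized step w <- (w - e d) / nu.
   Since rs maximizes a concave function over the convex set G, <1/rs, d> <= 0, so
   <1/rs, w> grows by a factor at least 1 + <w, d> e / 2.  If <w, d> stayed above
   eps, the step lengths e would be summable and w would converge to some W; as
   1/e is controlled by the inverses of the weights, W vanishes on a nonempty set Z
   of users.  The weights of Z cannot decrease to 0 unless
   sum_{k in Z} d_k / rs_k >= 0 infinitely often, and then an ultralimit is a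
   W-optimal point r of G with sum_{k in Z} r_k / rs_k >= |Z|.  If W charges a single
   user, this contradicts sum_k r_k / rs_k <= K.  Otherwise it contradicts the
   geometry of G: a point of G is a family of random variables x_0, ..., x_K with
   sum 1 and E x_k^2 <= E x_k, where x_0 is the idle slot; for a W-optimal family the
   users of Z coincide with the idle slot, and every weighted user has at least the
   probability of the idle slot, so that the users of Z have probability at most
   1 / (K + 1), less than the 1 / K that the fair rate requires. *)

(** * Tangent bounds for the logarithm *)

Section Logarithm.
Variable R : realType.

Lemma ln_le_tangent (x s : R) : 0 < x -> 0 < s -> ln x <= ln s + x / s - 1.
Proof.
move=> x0 s0.
have xs0 : 0 < x / s by rewrite divr_gt0.
have -> : ln x = ln s + ln (x / s) by rewrite ln_div ?posrE //; ring.
have := @le_ln1Dx R (x / s - 1) ltac:(lra).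
by rewrite addrCA subrr addr0; lra.
Qed.

(** Strictness comes from applying the tangent bound to the square root: with t = 1 / sqrt s it
    gives ln s >= 2 (1 - t), which exceeds 1 - t^2 by at least (1 - t)^2. *)
Lemma ln_gt_one_sub_inv (s : R) : 1 < s -> 1 - s^-1 < ln s.
Proof.
move=> s1; have s0 : 0 < s by lra.
have q0 : 0 < Num.sqrt s by rewrite sqrtr_gt0.
have e : s = Num.sqrt s * Num.sqrt s by rewrite -expr2 sqr_sqrtr // ltW.
have q1 : 1 < Num.sqrt s by rewrite -sqrtr1 ltr_sqrt.
have h := @ln_le_tangent 1 (Num.sqrt s) ltr01 q0.
rewrite ln1 div1r in h.
have -> : ln s = ln (Num.sqrt s) + ln (Num.sqrt s).
  by rewrite {1}e lnM ?posrE.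
rewrite {1}e invfM.
have V1 : (Num.sqrt s)^-1 < 1 by rewrite invf_lt1.
set t := (Num.sqrt s)^-1 in h V1 *.
have : 0 < (1 - t) * (1 - t) by rewrite mulr_gt0 //; lra.
by lra.
Qed.

End Logarithm.

(** * Policies: families of random variables with rates, and their convexity *)

Section Policies.
Variables (R : realType) (K : nat) (c : R) (m sg : 'I_K -> R).
Hypotheses (c_gt0 : 0 < c) (m_ge0 : forall k, 0 <= m k).
Hypothesis sg_ge0 : forall k, 0 <= sg k.

Implicit Types (q s t : R).

(* A pair (q, x) stands for the random variable q + <x, e>, with e a family of
   K uncorrelated standardized variables: "ball" says E Y^2 <= E Y. *)
Definition ball q (x : 'I_K -> R) : Prop := \sum_i x i ^+ 2 <= q - q ^+ 2.

(* The perspective bound r <= c q ln(1 + (m q + sg x) / q), as the family of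
   its tangent inequalities: it is then linear in (q, x, r). *)
Definition rate_le k q (x r : R) : Prop :=
  forall s, 0 < s -> r <= c * (q * (ln s - 1) + (q + (m k * q + sg k * x)) / s).

Definition slot k q (x : 'I_K -> R) (r : R) : Prop := [/\ 0 <= r, rate_le k q (x k) r & ball q x].

(* The last condition constrains the idle slot (1 - sum p, - sum X), which lies
   in the same ball as (sum p, sum X). *)
Definition policy (p : 'I_K -> R) (X : 'I_K -> 'I_K -> R) (r : 'I_K -> R) : Prop :=
  (forall k, slot k (p k) (X k) (r k)) /\
  ball (\sum_k p k) (fun i => \sum_k X k i).

Lemma sum_sqr_ge0 (x : 'I_K -> R) : 0 <= \sum_i x i ^+ 2.
Proof. by apply: sumr_ge0 => i _; exact: sqr_ge0. Qed.

Lemma sqr_le_sum_sqr (x : 'I_K -> R) i : x i ^+ 2 <= \sum_i x i ^+ 2.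
Proof.
rewrite (bigD1 i) //= lerDl; apply: sumr_ge0 => j _; exact: sqr_ge0.
Qed.

Lemma ball_prob q x : ball q x -> 0 <= q <= 1.
Proof. by rewrite /ball => h; have := sum_sqr_ge0 x; nra. Qed.

Lemma ball_norm q x i : ball q x -> -1 <= x i <= 1.
Proof.
by move=> h; have := ball_prob h; have := sqr_le_sum_sqr x i; move: h; rewrite /ball; nra.
Qed.

Lemma ball0 x : ball 0 x -> forall i, x i = 0.
Proof.
rewrite /ball expr0n subr0 => h i; have := sqr_le_sum_sqr x i => h1.
by apply/eqP; rewrite -(@sqrf_eq0 R); apply/eqP/le_anti; rewrite sqr_ge0 andbT; lra.
Qed.

Lemma ball_eq q x q' x' : q = q' -> x =1 x' -> ball q x -> ball q' x'.
Proof. by move=> <- e; rewrite /ball; under [X in _ -> X <= _]eq_bigr do rewrite -e. Qed.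

(* The defect of the ball inequality is a concave function of (q, x). *)
Lemma ball_slack_conv t q (x : 'I_K -> R) q' (x' : 'I_K -> R) : 0 <= t <= 1 ->
  (1 - t) * (q - q ^+ 2 - \sum_i x i ^+ 2) +
    t * (q' - q' ^+ 2 - \sum_i x' i ^+ 2) <=
  ((1 - t) * q + t * q') - ((1 - t) * q + t * q') ^+ 2 -
    \sum_i ((1 - t) * x i + t * x' i) ^+ 2.
Proof.
move=> t01.
have : \sum_i ((1 - t) * x i + t * x' i) ^+ 2 <=
    (1 - t) * (\sum_i x i ^+ 2) + t * \sum_i x' i ^+ 2.
  rewrite !mulr_sumr -big_split /=; apply: ler_sum => i _.
  have : 0 <= t * (1 - t) * (x i - x' i) ^+ 2.
    by rewrite mulr_ge0 ?sqr_ge0 // mulr_ge0 //; lra.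
  by lra.
have : 0 <= t * (1 - t) * (q - q') ^+ 2.
  by rewrite mulr_ge0 ?sqr_ge0 // mulr_ge0 //; lra.
by lra.
Qed.

Lemma ball_conv t q x q' x' : 0 <= t <= 1 -> ball q x -> ball q' x' ->
  ball ((1 - t) * q + t * q') (fun i => (1 - t) * x i + t * x' i).
Proof.
rewrite /ball => t01 h h'; have := ball_slack_conv q x q' x' t01.
have : 0 <= (1 - t) * (q - q ^+ 2 - \sum_i x i ^+ 2) by rewrite mulr_ge0 //; lra.
have : 0 <= t * (q' - q' ^+ 2 - \sum_i x' i ^+ 2) by rewrite mulr_ge0 //; lra.
by lra.
Qed.

Lemma rate_le_conv k t q x r q' x' r' : 0 <= t <= 1 ->
  rate_le k q x r -> rate_le k q' x' r' ->
  rate_le k ((1 - t) * q + t * q') ((1 - t) * x + t * x') ((1 - t) * r + t * r').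
Proof.
move=> t01 h h' s s0.
have := ler_wpM2l (_ : 0 <= 1 - t) (h s s0); have := ler_wpM2l (_ : 0 <= t) (h' s s0).
by move=> /(_ ltac:(lra)) ? /(_ ltac:(lra)) ?; lra.
Qed.

Lemma slot_conv k t q x r q' x' r' : 0 <= t <= 1 ->
  slot k q x r -> slot k q' x' r' ->
  slot k ((1 - t) * q + t * q') (fun i => (1 - t) * x i + t * x' i)
    ((1 - t) * r + t * r').
Proof.
move=> t01 [h1 h2 h3] [h1' h2' h3']; split; last exact: ball_conv.
  by rewrite addr_ge0 // mulr_ge0 //; lra.
exact: rate_le_conv.
Qed.

Lemma policy_conv t p X r p' X' r' : 0 <= t <= 1 ->
  policy p X r -> policy p' X' r' ->
  policy (fun k => (1 - t) * p k + t * p' k)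
    (fun k i => (1 - t) * X k i + t * X' k i) (fun k => (1 - t) * r k + t * r' k).
Proof.
move=> t01 [h hb] [h' hb']; split; first by move=> k; exact: slot_conv.
apply: ball_eq (ball_conv t01 hb hb'); first by rewrite big_split /= !mulr_sumr.
by move=> i; rewrite big_split /= !mulr_sumr.
Qed.

Lemma rate_le_mean k q x r : rate_le k q x r -> r <= c * (m k * q + sg k * x).
Proof. by move=> /(_ 1 ltr01); rewrite ln1 divr1; lra. Qed.

Lemma rate_le_zero k q : 0 <= q -> rate_le k q 0 (q * (c * ln (1 + m k))).
Proof.
move=> q0 s s0; have := m_ge0 k => mk.
have := ln_le_tangent (_ : 0 < 1 + m k) s0 => /(_ ltac:(lra)) h.
have : q * c * ln (1 + m k) <= q * c * (ln s + (1 + m k) / s - 1).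
  by apply: ler_wpM2l => //; rewrite mulr_ge0 // ltW.
by lra.
Qed.

Lemma ln1m_ge0 k : 0 <= c * ln (1 + m k).
Proof. by apply: mulr_ge0; [exact: ltW | rewrite ln_ge0 // lerDl]. Qed.

Lemma rate_le_zero0 k q : 0 <= q -> rate_le k q 0 0.
Proof.
move=> q0 s s0; apply: le_trans (rate_le_zero k q0 s0).
by rewrite mulr_ge0 // ln1m_ge0.
Qed.

Lemma rate_le_zeroP k q r : 0 <= q -> rate_le k q 0 r -> r <= q * (c * ln (1 + m k)).
Proof.
(* The tangent at [s = 1 + m k] touches the perspective when [x = 0]. *)
move=> q0 /(_ (1 + m k)); have mk := m_ge0 k => /(_ ltac:(lra)).
rewrite mulr0 addr0 -[X in (X + _) / _](mulr1 q) [m k * q]mulrC -mulrDr mulfK; last by lra.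
by lra.
Qed.

Lemma rate_le_prob k q x r : ball q x -> rate_le k q (x k) r -> 0 < r -> 0 < q.
Proof.
move=> hb h r0; have /andP[] := ball_prob hb; rewrite le_eqVlt => /orP[/eqP q0 _|//].
rewrite -q0 in h hb; have := rate_le_mean h; rewrite (ball0 hb) => h'; lra.
Qed.

(** For fixed [x], the tangent bound at [s'] is linear in [q] with slope c (ln s' - (1 - 1/s') + m k
    / s'), which is positive as soon as s' > 1. *)
Lemma rate_le_incr k q q' x r : 0 < q -> q < q' -> 0 < r -> rate_le k q x r ->
  exists2 r', r < r' & rate_le k q' x r'.
Proof.
move=> q0 qq' r0 h; have := rate_le_mean h => hy; have mk := m_ge0 k.
set y := m k * q' + sg k * x.
(* The tangent at 1 turns the positive rate into a positive mean at [q], and the mean grows with [q]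
   since [m k >= 0]. *)
have y0 : 0 < y.
  have : 0 < m k * q + sg k * x by rewrite -(pmulr_rgt0 _ c_gt0); lra.
  by rewrite /y; nra.
have q'0 : 0 < q' by lra.
(* The tangent bounds at [q'] are smallest at [s'], where they equal c q' ln s'; this value is the
   new rate. *)
set s' := 1 + y / q'.
have s1 : 1 < s' by rewrite /s' ltrDl divr_gt0.
have s0 : 0 < s' by lra.
have e : (q' + y) / s' = q'.
  have -> : q' + y = q' * s' by rewrite /s' mulrDr mulr1 mulrCA divff ?mulr1 //; lra.
  by rewrite mulfK //; lra.
exists (c * (q' * ln s')); last first.
  move=> s sp; rewrite -/y ler_pM2l //.
  have := ler_wpM2l (ltW q'0) (ln_le_tangent s0 sp).
  have -> : (q' + y) / s = q' * (s' / s).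
    by rewrite /s' mulrA mulrDr mulr1 [q' * (y / q')]mulrCA divff ?mulr1 //; lra.
  by lra.
apply: le_lt_trans (h _ s0) _; rewrite ltr_pM2l //.
have hl := ln_gt_one_sub_inv s1.
have V0 : 0 < s'^-1 by rewrite invr_gt0.
have : q' * ln s' = q' * (ln s' - 1) + (q' + y) / s' by rewrite e; lra.
move=> ->; rewrite -subr_gt0.
have -> : q' * (ln s' - 1) + (q' + y) / s' -
   (q * (ln s' - 1) + (q + (m k * q + sg k * x)) / s') =
   (q' - q) * (ln s' - (1 - s'^-1)) + (q' - q) * m k * s'^-1 by rewrite /y; ring.
apply: ltr_wpDr; first by rewrite mulr_ge0 // ?mulr_ge0 //; lra.
by rewrite mulr_gt0 //; lra.
Qed.


Lemma policy_rate_le p X r k : policy p X r -> 0 <= r k <= c * (m k + sg k).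
Proof.
move=> [h _]; have [r0 hr hb] := h k; rewrite r0 /=; apply: le_trans (rate_le_mean hr) _.
rewrite ler_pM2l //; have := ball_prob hb; have := ball_norm k hb.
by have := m_ge0 k; have := sg_ge0 k; nra.
Qed.

(** * Exchange arguments on optimal policies *)

Definition upd (T : Type) (f : 'I_K -> T) j (a : T) : 'I_K -> T :=
  fun l => if l == j then a else f l.

Lemma sum_upd (f : 'I_K -> R) j a : \sum_l upd f j a l = \sum_l f l - f j + a.
Proof.
rewrite (bigD1 j) //= [in RHS](bigD1 j) //= /upd eqxx.
under eq_bigr => i /negPf -> do [].
by ring.
Qed.

Lemma sum_upd_col X j (x : 'I_K -> R) i :
  \sum_l upd X j x l i = \sum_l X l i - X j i + x i.
Proof.
rewrite -(sum_upd (fun l => X l i)); apply: eq_bigr => l _.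
by rewrite /upd; case: eqP.
Qed.

Lemma sum_mul_upd (W r : 'I_K -> R) j a :
  \sum_k W k * upd r j a k = \sum_k W k * r k + W j * (a - r j).
Proof.
transitivity (\sum_k upd (fun k => W k * r k) j (W j * a) k).
  by apply: eq_bigr => k _; rewrite /upd; case: eqP => // ->.
by rewrite sum_upd; ring.
Qed.

Lemma policy_upd p X r j q x a : policy p X r -> slot j q x a ->
  ball (\sum_k p k - p j + q) (fun i => \sum_l X l i - X j i + x i) ->
  policy (upd p j q) (upd X j x) (upd r j a).
Proof.
move=> [h _] hj hb; split; last by rewrite sum_upd; apply: ball_eq hb => // i; rewrite sum_upd_col.
by move=> k; rewrite /upd; case: eqP => // ->.
Qed.

Definition optimal (W r : 'I_K -> R) : Prop :=
  forall p X r', policy p X r' -> \sum_k W k * r' k <= \sum_k W k * r k.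

(** If the constraint on the idle slot had slack, slot j could move a little towards the better slot
    and raise the objective. *)
Lemma optimal_no_slack W p X r j q x a : policy p X r -> optimal W r ->
  0 < W j -> slot j q x a -> r j < a ->
  (\sum_k p k) - (\sum_k p k) ^+ 2 <= \sum_i (\sum_k X k i) ^+ 2.
Proof.
move=> hp ho Wj hs ra; rewrite leNgt; apply/negP => hlt.
set P := \sum_k p k in hlt *.
set g0 := P - P ^+ 2 - \sum_i (\sum_k X k i) ^+ 2.
set S1 := fun i => \sum_k X k i - X j i + x i.
set g1 := (P - p j + q) - (P - p j + q) ^+ 2 - \sum_i S1 i ^+ 2.
have g0p : 0 < g0 by rewrite /g0; lra.
have g1n : 0 <= `|g1| by [].
have g1l : - `|g1| <= g1 by rewrite lerNl ler_normr lexx orbT.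
(* [g1] is the defect after a full replacement of slot j; this [t] makes (1 - t) g0 - t |g1| = 0, so
   the interpolated defect stays nonnegative. *)
set t := g0 / (g0 + `|g1|).
have tp : 0 < t by rewrite divr_gt0 //; lra.
have t1 : t <= 1 by rewrite ler_pdivrMr ?mul1r; lra.
have te : t * (g0 + `|g1|) = g0 by rewrite divfK //; lra.
have t01 : 0 <= t <= 1 by lra.
have [hsl _] := hp.
have hj := slot_conv t01 (hsl j) hs.
have := policy_upd hp hj; rewrite -/P => /(_ _)/ho; rewrite sum_mul_upd.
have : 0 < W j * ((1 - t) * r j + t * a - r j).
  have -> : (1 - t) * r j + t * a - r j = t * (a - r j) by ring.
  by apply: mulr_gt0 => //; apply: mulr_gt0 => //; rewrite subr_gt0.
move=> h1 h2; suff : ball (P - p j + ((1 - t) * p j + t * q))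
   (fun i => \sum_l X l i - X j i + ((1 - t) * X j i + t * x i)) by move/h2; lra.
have hc := ball_slack_conv P (fun i => \sum_k X k i) (P - p j + q) S1 t01.
apply: (@ball_eq ((1 - t) * P + t * (P - p j + q)) (fun i => (1 - t) * (\sum_k X k i) + t * S1 i)).
- by ring.
- by move=> i; rewrite /S1; ring.
rewrite /ball; move: hc; rewrite -/g0 -/g1.
have : 0 <= t * (g1 + `|g1|) by rewrite mulr_ge0 //; lra.
by lra.
Qed.

(** Either the given slot already earns more, or [r] is positive and raising the probability to 1/2,
    where q - q^2 is largest, keeps the ball and increases the rate. *)
Lemma slot_improvable j qs xs a q x r : slot j qs xs a -> 0 < a ->
  slot j q x r -> q < 1 / 2 -> exists q' x' r', slot j q' x' r' /\ r < r'.
Proof.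
move=> ha a0 [r0 hr hb] q2.
have [ra|ar] := ltP r a; first by exists qs, xs, a.
have rp : 0 < r by apply: lt_le_trans ar.
have q0 := rate_le_prob hb hr rp.
have [r' rr' hr'] := rate_le_incr q0 q2 rp hr.
exists (1 / 2), x, r'; split => //; split => //; first by lra.
by rewrite /ball in hb *; apply: le_trans hb _; nra.
Qed.

Lemma optimal_idle_tight W p X r j qs xs a : policy p X r -> optimal W r ->
  0 < W j -> slot j qs xs a -> 0 < a -> (r j = 0 \/ p j < 1 / 2) ->
  (\sum_k p k) - (\sum_k p k) ^+ 2 <= \sum_i (\sum_k X k i) ^+ 2.
Proof.
move=> hp ho Wj hs a0 [rj|pj].
  by apply: optimal_no_slack hp ho Wj hs _; rewrite rj.
have [q' [x' [r' [hs' rr']]]] := slot_improvable hs a0 (hp.1 j) pj.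
exact: optimal_no_slack hp ho Wj hs' rr'.
Qed.

(** The rate of user k depends only on [p k] and the diagonal entry [X k k], so erasing the columns
    of A costs rate only to users of A, while every ball inequality is relaxed. *)
Lemma policy_zero_cols (A : pred 'I_K) p X r : policy p X r ->
  policy p (fun k i => if A i then 0 else X k i) (fun k => if A k then 0 else r k).
Proof.
move=> [h hb]; split=> [k|].
  have [h1 h2 h3] := h k; split; first by case: ifP.
    by case: ifP => // _; apply: rate_le_zero0; have := ball_prob h3; lra.
  apply: le_trans h3; apply: ler_sum => i _; case: ifP => // _.
  by rewrite expr0n /= sqr_ge0.
apply: le_trans hb; apply: ler_sum => i _; case: (A i) => //.
by rewrite big1 // expr0n /= sqr_ge0.
Qed.

(* A user whose rate does not matter is averaged with the idle slot; strict
   convexity of the ball leaves slack unless the two already coincide. *)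
Lemma policy_average_idle (A : pred 'I_K) p X r l : policy p X r -> A l ->
  exists p' X', [/\ policy p' X' (fun k => if A k then 0 else r k),
    forall k, ~~ A k -> p' k = p k &
    \sum_i (\sum_k X' k i) ^+ 2 + X l l ^+ 2 / 2 + ((1 - \sum_k p k - p l) / 2) ^+ 2
      <= (\sum_k p' k) - (\sum_k p' k) ^+ 2].
Proof.
move=> hp Al; have h0 := policy_zero_cols A hp.
set X0 := (fun k i => if A i then 0 else X k i) in h0.
set r0 := (fun k => if A k then 0 else r k) in h0 *.
set P := \sum_k p k.
set q := (1 - P + p l) / 2.
set S := fun i => \sum_k X0 k i.
set x := fun i => (X0 l i - S i) / 2.
have hl : \sum_i X0 l i ^+ 2 + X l l ^+ 2 <= p l - p l ^+ 2.
  have [[_ _ hb] _] := (hp.1 l, erefl tt); apply: le_trans hb.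
  rewrite (bigD1 l) //= [X in _ <= X](bigD1 l) //= /X0 Al expr0n /= add0r addrC lerD2r.
  by apply: ler_sum => i _; case: ifP => // _; rewrite expr0n /= sqr_ge0.
have hS : \sum_i S i ^+ 2 <= P - P ^+ 2 by exact: h0.2.
have hx : \sum_i x i ^+ 2 <= (\sum_i X0 l i ^+ 2) / 2 + (\sum_i S i ^+ 2) / 2.
  rewrite !mulr_suml -big_split /=; apply: ler_sum => i _.
  by rewrite /x; have := sqr_ge0 (X0 l i + S i); lra.
(* [(q, x)] is the midpoint of slot l and the idle slot [(1 - P, - S)]. The slack has two sources:
   the erased entry [X l l] and the strict concavity of q - q^2. *)
have hbx : \sum_i x i ^+ 2 + X l l ^+ 2 / 2 + ((1 - P - p l) / 2) ^+ 2 <= q - q ^+ 2.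
  by rewrite /q; lra.
have hb : ball q x by rewrite /ball; have := sqr_ge0 (X l l); have := sqr_ge0 ((1 - P - p l) / 2); lra.
have Sl : S l = 0 by rewrite /S big1 // => k _; rewrite /X0 Al.
have hs : slot l q x 0.
  split => //; rewrite /x Sl /X0 Al subrr mul0r; apply: rate_le_zero0.
  by have := ball_prob hb; lra.
(* The new total is [(1 - q, - x)], so the idle slot has become [(q, x)] too. *)
have eS i : S i - X0 l i + x i = - x i by rewrite /x; lra.
have eP : P - p l + q = 1 - q by rewrite /q; lra.
have := policy_upd h0 hs; rewrite -/P eP => /(_ _) hpol.
exists (upd p l q), (upd X0 l x); split.
- have -> : r0 = upd r0 l 0.
    by apply/funext => k; rewrite /upd /r0; case: eqP => // ->; rewrite Al.
  apply: hpol; rewrite /ball.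
  under eq_bigr => i _ do rewrite -/(S i) eS sqrrN.
  by rewrite /ball in hb; lra.
- by move=> k Ak; rewrite /upd; case: eqP => // e; rewrite e Al in Ak.
- rewrite sum_upd -/P eP.
  under eq_bigr => i _ do rewrite sum_upd_col -/(S i) eS sqrrN.
  by lra.
Qed.

(** Erasing the entries of the other users in column j changes no rate and replaces the column sum
    by the smaller [X j j]. *)
Lemma policy_clean_col p X r j : policy p X r ->
  X j j ^+ 2 < (\sum_k X k j) ^+ 2 ->
  exists X', policy p X' r /\
    \sum_i (\sum_k X' k i) ^+ 2 < (\sum_k p k) - (\sum_k p k) ^+ 2.
Proof.
move=> [h hb] hj.
set X' := fun l i => if (i == j) && (l != j) then 0 else X l i.
have e i : i != j -> \sum_k X' k i = \sum_k X k i.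
  by move=> /negPf ij; apply: eq_bigr => k _; rewrite /X' ij.
have ej : \sum_k X' k j = X j j.
  rewrite (bigD1 j) //= big1 => [|k kj]; first by rewrite /X' !eqxx addr0.
  by rewrite /X' eqxx kj.
have lt : \sum_i (\sum_k X' k i) ^+ 2 < (\sum_k p k) - (\sum_k p k) ^+ 2.
  apply: lt_le_trans hb; rewrite (bigD1 j) //= [X in _ < X](bigD1 j) //= ej.
  rewrite ltr_leD //; apply: ler_sum => i ij; by rewrite e.
exists X'; split => //; split; last exact: ltW.
move=> k; have [h1 h2 h3] := h k; split => //.
  by rewrite /X'; case: (k == j).
apply: le_trans h3; apply: ler_sum => i _; rewrite /X'; case: ifP => // _.
by rewrite expr0n /= sqr_ge0.
Qed.

(* Outside direction j and after centering at 1/2, slot j lies in a ball of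
   radius a and the idle slot in one of radius b >= a.  Sharing their sum in the
   proportion a : b respects both radii and raises the probability of slot j. *)
Lemma ball_transfer j q x P S : ball q x -> ball P S ->
  q <= P -> q < 1 - P -> S j ^+ 2 <= x j ^+ 2 ->
  exists q' x', [/\ q < q', x' j = x j, ball q' x' &
    ball (P - q + q') (fun i => S i - x i + x' i)].
Proof.
rewrite /ball => hq hP qleP qP hS.
have q01 := ball_prob hq; have P01 := ball_prob hP.
have xj4 : x j ^+ 2 < 1 / 4.
  have : 0 < (1 / 2 - q) * (1 / 2 - q) by apply: mulr_gt0; lra.
  by have := sqr_le_sum_sqr x j; lra.
set a := Num.sqrt (1 / 4 - x j ^+ 2); set b := Num.sqrt (1 / 4 - S j ^+ 2).
have a2 : a ^+ 2 = 1 / 4 - x j ^+ 2 by rewrite sqr_sqrtr //; lra.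
have b2 : b ^+ 2 = 1 / 4 - S j ^+ 2 by rewrite sqr_sqrtr //; lra.
have a0 : 0 < a by rewrite sqrtr_gt0; lra.
have ab : a <= b by rewrite ler_sqrt; lra.
have b0 : 0 < b by lra.
(* The squared norm, outside direction j, of the sum of the centered slot j and the centered idle
   slot; [EL] is the triangle inequality. *)
set E := \sum_(i | i != j) (x i - S i) ^+ 2 + (q - P) ^+ 2.
have E0 : 0 <= E by rewrite addr_ge0 ?sqr_ge0 // sumr_ge0 // => i _; rewrite sqr_ge0.
have EL : E <= (a + b) ^+ 2.
  have hA : \sum_(i | i != j) x i ^+ 2 + (q - 1 / 2) ^+ 2 <= a ^+ 2.
    by move: hq; rewrite (bigD1 j) //=; lra.
  have hB : \sum_(i | i != j) S i ^+ 2 + (P - 1 / 2) ^+ 2 <= b ^+ 2.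
    by move: hP; rewrite (bigD1 j) //=; lra.
  have key u v : a * b * (u - v) ^+ 2 <= (a + b) * (b * u ^+ 2 + a * v ^+ 2).
    by have := sqr_ge0 (b * u + a * v); lra.
  rewrite -(ler_pM2l (_ : 0 < a * b)) ?mulr_gt0 //.
  have h1 : a * b * E <= (a + b) * (b * (\sum_(i | i != j) x i ^+ 2 + (q - 1 / 2) ^+ 2)
       + a * (\sum_(i | i != j) S i ^+ 2 + (P - 1 / 2) ^+ 2)).
    have h2 : a * b * \sum_(i | i != j) (x i - S i) ^+ 2 <=
        (a + b) * (b * (\sum_(i | i != j) x i ^+ 2) + a * (\sum_(i | i != j) S i ^+ 2)).
      rewrite !mulr_sumr -big_split /= mulr_sumr; apply: ler_sum => i _; exact: key.
    have := key (q - 1 / 2) (P - 1 / 2).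
    have -> : q - 1 / 2 - (P - 1 / 2) = q - P by ring.
    by rewrite /E; lra.
  apply: le_trans h1 _.
  have -> : a * b * (a + b) ^+ 2 = (a + b) * (b * a ^+ 2 + a * b ^+ 2) by ring.
  by rewrite ler_pM2l ?lerD // ?ler_pM2l //; lra.
set la := a / (a + b).
have la0 : 0 < la by rewrite divr_gt0 //; lra.
have la2 : la <= 1 / 2 by rewrite ler_pdivrMr; lra.
have laE : la * (a + b) = a by rewrite divfK //; lra.
have lbE : (1 - la) * (a + b) = b by lra.
have hl : la ^+ 2 * E <= a ^+ 2.
  have -> : a ^+ 2 = la ^+ 2 * (a + b) ^+ 2 by rewrite -exprMn laE.
  by apply: ler_wpM2l => //; exact: sqr_ge0.
have hm : (1 - la) ^+ 2 * E <= b ^+ 2.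
  have -> : b ^+ 2 = (1 - la) ^+ 2 * (a + b) ^+ 2 by rewrite -exprMn lbE.
  by apply: ler_wpM2l => //; exact: sqr_ge0.
exists (1 / 2 + la * (q - P)), (fun i => if i == j then x j else la * (x i - S i)).
have lS : \sum_(i | i != j) (la * (x i - S i)) ^+ 2 = la ^+ 2 * \sum_(i | i != j) (x i - S i) ^+ 2.
  by rewrite mulr_sumr; apply: eq_bigr => i _; rewrite exprMn.
have mS : \sum_(i | i != j) ((1 - la) * (x i - S i)) ^+ 2 = (1 - la) ^+ 2 * \sum_(i | i != j) (x i - S i) ^+ 2.
  by rewrite mulr_sumr; apply: eq_bigr => i _; rewrite exprMn.
split.
(* As la <= 1/2, the new probability is at least the average of [q] and the larger idle probability
   1 - P. *)
- have : 0 <= (1 / 2 - la) * (P - q) by rewrite mulr_ge0 //; lra.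
  by lra.
- by rewrite eqxx.
- rewrite (bigD1 j) //= eqxx.
  under eq_bigr => i /negPf -> do [].
  by rewrite lS; move: hl; rewrite /E; lra.
- rewrite (bigD1 j) //= eqxx.
  have -> : \sum_(i | i != j) (S i - x i + (if i == j then x j else la * (x i - S i))) ^+ 2
     = \sum_(i | i != j) ((1 - la) * (x i - S i)) ^+ 2.
    by apply: eq_bigr => i /negPf ->; ring.
  by rewrite mS; move: hm; rewrite /E; lra.
Qed.

Lemma sum_ge3 (f : 'I_K -> R) a b d : (forall i, 0 <= f i) ->
  a != b -> a != d -> b != d -> f a + f b + f d <= \sum_i f i.
Proof.
move=> f0 ab ad bd.
rewrite (bigD1 a) //= (bigD1 b) /=; last by rewrite eq_sym.
rewrite (bigD1 d) /=; last by rewrite ![d == _]eq_sym ad bd.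
set z := (X in _ + (_ + (_ + X))).
have : 0 <= z by apply: sumr_ge0 => i _.
by lra.
Qed.

Lemma policy_single k :
  policy (fun l => (l == k)%:R) (fun _ _ => 0) (fun l => (l == k)%:R * (c * ln (1 + m k))).
Proof.
split=> [l|].
  split.
  - by rewrite mulr_ge0 ?ler0n // ln1m_ge0.
  - by case: eqP => [->|_] /=; [exact: rate_le_zero | rewrite mul0r; exact: rate_le_zero0].
  - rewrite /ball big1 => [|i _]; last by rewrite expr0n.
    by case: (l == k); rewrite /=; lra.
rewrite /ball big1 => [|i _]; last by rewrite big1 // expr0n.
rewrite (bigD1 k) //= eqxx big1 => [|l /negPf -> //].
by rewrite /=; lra.
Qed.

(* Under weights W supported on at least two users, an optimal policy treats
   every user of zero weight like the idle slot; as the share of such a user is at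
   least 1 / K when its rate is the proportionally fair one, some other user has a
   smaller share than the idle slot, and could profitably be given more. *)
Lemma unweighted_rate_lt (W ps rs p r : 'I_K -> R) Xs X j1 j2 k :
  policy ps Xs rs -> (forall l, 0 < rs l) ->
  (forall p' X' r', policy p' X' r' -> \sum_l r' l / rs l <= K%:R) ->
  policy p X r -> optimal W r -> (forall l, 0 <= W l) ->
  j1 != j2 -> 0 < W j1 -> 0 < W j2 -> W k = 0 -> r k < rs k.
Proof.
move=> hps rs0 pf hp ho W0 j12 Wj1 Wj2 Wk; rewrite ltNge; apply/negP => hk.
have hs := hp.1.
have r0 l : 0 <= r l by have [] := hs l.
have p01 l : 0 <= p l <= 1 by have [_ _ /ball_prob] := hs l.
have P01 := ball_prob hp.2.
have rk : 0 < r k by apply: lt_le_trans hk.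
have pk : 0 < p k by have [_ h1 h2] := hs k; exact: rate_le_prob h2 h1 rk.
(* Two weighted users with share at least 1/2 would leave nothing for user k. *)
have [j Wj pj] : exists2 j, 0 < W j & p j < 1 / 2.
  have [h1|h1] := ltP (p j1) (1 / 2); first by exists j1.
  have [h2|h2] := ltP (p j2) (1 / 2); first by exists j2.
  have j1k : j1 != k by apply: contraTneq Wj1 => ->; rewrite Wk ltxx.
  have j2k : j2 != k by apply: contraTneq Wj2 => ->; rewrite Wk ltxx.
  have := @sum_ge3 p j1 j2 k (fun l => ltac:(have := p01 l; lra)) j12 j1k j2k.
  by lra.
set A : pred 'I_K := fun l => W l * r l == 0.
(* Averaging a user of A with the idle slot preserves the objective, so tightness of the idle
   constraint forces both slack terms to vanish. *)
have hA l : A l -> X l l = 0 /\ p l = 1 - \sum_l p l.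
  move=> Al; have [p' [X' [hp' e' sl]]] := policy_average_idle hp Al.
  have ho' : optimal W (fun k => if A k then 0 else r k).
    move=> p1 X1 r1 /ho h1; apply: le_trans h1 _; rewrite le_eqVlt; apply/orP; left.
    by apply/eqP; apply: eq_bigr => i _; case: ifP => // /eqP ->; rewrite mulr0.
  have := optimal_idle_tight hp' ho' Wj (hps.1 j) (rs0 j) => /(_ _) h1.
  have {}h1 := h1 ltac:(by case: ifP => Aj; [left | right; rewrite e' ?Aj]).
  have s1 := sqr_ge0 (X l l); have s2 := sqr_ge0 ((1 - \sum_l p l - p l) / 2).
  have /eqP : X l l ^+ 2 = 0 by lra.
  have /eqP : ((1 - \sum_l p l - p l) / 2) ^+ 2 = 0 by lra.
  by rewrite !sqrf_eq0 => /eqP e1 /eqP e2; split => //; lra.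
have [Xkk pke] := hA k ltac:(by rewrite /A Wk mul0r).
set be := c * ln (1 + m k).
have hrk : r k <= p k * be.
  by have [_ h1 _] := hs k; rewrite Xkk in h1; apply: rate_le_zeroP h1; lra.
have be0 : 0 < be by rewrite -(pmulr_rgt0 _ pk); lra.
have hK : be <= K%:R * rs k.
  have := pf _ _ _ (policy_single k).
  rewrite (bigD1 k) //= eqxx mul1r big1 => [|l /negPf ->]; last by rewrite !mul0r.
  by rewrite addr0 ler_pdivrMr.
(* [be] is what user k earns alone, so be <= K rs_k <= K r_k <= K p_k be. *)
have K1 : 1 <= K%:R * p k.
  rewrite -(ler_pM2r be0) mul1r -mulrA; apply: le_trans hK _.
  by apply: ler_wpM2l => //; lra.
(* Otherwise K p_k <= 1 - p_k, against K p_k >= 1. *)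
have [j' hj'] : exists j', p j' < 1 - \sum_l p l.
  apply/not_existsP => hn.
  have : \sum_(l < K) (1 - \sum_l p l) <= \sum_l p l.
    by apply: ler_sum => l _; rewrite leNgt; apply/negP/hn.
  by rewrite sumr_const card_ord -mulr_natl -pke; lra.
have nA : ~~ A j' by apply/negP => /hA[_ e]; rewrite -e ltxx in hj'.
have Wj' : 0 < W j'.
  by rewrite lt_neqAle W0 andbT eq_sym; apply: contra nA => /eqP e; rewrite /A e mul0r.
have rj' : 0 < r j'.
  by rewrite lt_neqAle r0 andbT eq_sym; apply: contra nA => /eqP e; rewrite /A e mulr0.
(* In the first case cleaning column j' creates forbidden slack; in the second the idle slot can
   yield probability to user j'. *)
have [h1|h1] := ltP (X j' j' ^+ 2) ((\sum_l X l j') ^+ 2).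
  have [X' [hX' sl]] := policy_clean_col hp h1.
  by have := optimal_idle_tight hX' ho Wj (hps.1 j) (rs0 j) (or_intror pj); lra.
have pP : p j' <= \sum_l p l.
  by rewrite (bigD1 j') //= lerDl sumr_ge0 // => i _; have := p01 i; lra.
have [_ hr hb] := hs j'.
have [q [x [pq xj hb1 hb2]]] := ball_transfer hb hp.2 pP hj' h1.
have [a ra ha] := rate_le_incr (rate_le_prob hb hr rj') pq rj' hr.
have hsl : slot j' q x a by split; rewrite ?xj //; lra.
have := ho _ _ _ (policy_upd hp hsl hb2); rewrite sum_mul_upd.
have : 0 < W j' * (a - r j') by rewrite mulr_gt0 // subr_gt0.
by lra.
Qed.
End Policies.

(** * Feasible rate vectors as rates of policies, and proportional fairness *)

Section Feasible.
Variables (R : realType) (K : nat) (D0 B : R) (m v : 'I_K -> R).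
Hypotheses (D0_gt0 : 0 < D0) (B_gt0 : 0 < B).
Hypothesis v_ge0 : forall k, 0 <= v k.

Let c : R := D0 * B / ln 2.
Let sg (k : 'I_K) : R := Num.sqrt (v k).

Lemma ln2_gt0 : 0 < ln 2 :> R.
Proof. by rewrite ln_gt0 // ltr1n. Qed.

Lemma scale_gt0 : 0 < c.
Proof. by rewrite /c divr_gt0 ?mulr_gt0 // ln2_gt0. Qed.

Lemma mulmx_form (H : 'M[R]_K) (u w : 'cV[R]_K) :
  (u^T *m H *m w) 0 0 = \sum_i \sum_j u i 0 * H i j * w j 0.
Proof.
rewrite -mulmxA mxE; apply: eq_bigr => i _; rewrite !mxE mulr_sumr.
by apply: eq_bigr => j _; rewrite mulrA.
Qed.

Lemma psd_form (Hxx Hxp Hpp : 'M[R]_K) (a b : 'I_K -> R) :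
  psd (block_mx Hxx Hxp Hxp^T Hpp) ->
  (forall i j, Hpp i j = (if i == j then v i else 0)) ->
  0 <= \sum_i \sum_j a i * Hxx i j * a j + 2 * (\sum_i \sum_j a i * Hxp i j * b j)
    + \sum_i v i * b i ^+ 2.
Proof.
move=> [_ h] hpp; set u := \col_i a i; set f := \col_i b i.
have := h (col_mx u f); rewrite tr_col_mx mul_row_block mul_row_col !mulmxDl.
rewrite ![fun_of_matrix (_ + _) _ _]mxE.
have -> : (f^T *m Hxp^T *m u) 0 0 = (u^T *m Hxp *m f) 0 0.
  have -> : f^T *m Hxp^T *m u = (u^T *m Hxp *m f)^T.
    by rewrite !trmx_mul trmxK mulmxA.
  by rewrite mxE.
have e1 (H : 'M[R]_K) (s t : 'I_K -> R) :
    ((\col_i s i)^T *m H *m (\col_i t i)) 0 0 = \sum_i \sum_j s i * H i j * t j.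
  by rewrite mulmx_form; apply: eq_bigr => i _; apply: eq_bigr => j _; rewrite !mxE.
rewrite /u /f !e1.
have -> : \sum_i \sum_j b i * Hpp i j * b j = \sum_i v i * b i ^+ 2.
  apply: eq_bigr => i _; rewrite (bigD1 i) //= big1 ?hpp ?eqxx => [|j ji]; first by ring.
  by rewrite hpp eq_sym (negPf ji) mulr0 mul0r.
by lra.
Qed.

(** For [q > 0] the tangent at 1 + y/q is exact, and [r >= 0] makes [y >= 0], so the logarithm is
    defined. At [q = 0] the ball forces [y = 0], and both sides say [r <= 0]. *)
Lemma rate_okP k q y x r : 0 <= r -> ball q x -> y = m k * q + sg k * x k ->
  rate_ok D0 B q y r <-> rate_le c m sg k q (x k) r.
Proof.
rewrite /rate_ok => r0 hb ye; have c0 := scale_gt0; have /andP[q0 q1] := ball_prob hb.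
have -> t : D0 * B * (q * log2 t) = c * (q * ln t).
  by rewrite /log2 /c; ring.
split=> [[h1 h2] s s0|h].
  rewrite -ye; have [qe|qn] := eqVneq q 0.
    have xk : x k = 0 by rewrite qe in hb; exact: ball0 hb k.
    have y0 : y = 0 by rewrite ye qe xk !mulr0 addr0.
    rewrite y0 qe; have := h1 qe; lra.
  have qp : 0 < q by rewrite lt_neqAle eq_sym qn.
  have [h3 h4] := h2 (elimN eqP qn).
  apply: le_trans h4 _; rewrite ler_pM2l //.
  have := ler_wpM2l q0 (ln_le_tangent h3 s0).
  have -> : (q + y) / s = q * ((1 + y / q) / s).
    by rewrite mulrA mulrDr mulr1 [q * (y / q)]mulrCA divff // mulr1.
  by lra.
split=> [qe|/eqP qn].
  have xk : x k = 0 by rewrite qe in hb; exact: ball0 hb k.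
  by have := rate_le_mean h; rewrite qe xk !mulr0 addr0 mulr0.
have qp : 0 < q by rewrite lt_neqAle eq_sym qn.
have y0 : 0 <= y.
  by rewrite ye -(pmulr_rge0 _ c0); apply: le_trans r0 (rate_le_mean h).
have s0 : 0 < 1 + y / q by apply: ltr_pwDl => //; rewrite divr_ge0.
split => //; have := h _ s0; rewrite -ye.
have -> : q + y = q * (1 + y / q) by rewrite mulrDr mulr1 mulrCA divff // mulr1.
by rewrite mulfK ?lt0r_neq0 // mulrBr mulr1 subrK.
Qed.

(* X is read off the cross-covariances; the Schur complement of the diagonal
   block shows that X X^T is dominated by Hxx.  Where v i = 0, the column i of X
   is 0 because division by 0 returns 0. *)
Lemma inG_policy r : inG D0 B m v r -> exists p X, policy c m sg p X r.
Proof.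
move=> [p [y [Hxx [Hxp [Hpp [h1 [h2 [h3 [h4 [h5 [h6 h7]]]]]]]]]]].
set X := fun l i => Hxp l i / sg i.
have schur a : \sum_i (\sum_l a l * X l i) ^+ 2 <= \sum_i \sum_j a i * Hxx i j * a j.
  (* Where [v i > 0], this second block minimizes the quadratic form for fixed [a]. *)
  have := @psd_form Hxx Hxp Hpp a (fun i => - (\sum_l a l * Hxp l i) / v i) h7 h4.
  rewrite [X in _ + 2 * X + _]exchange_big /= mulr_sumr -addrA -big_split /=.
  set z := (X in _ + X).
  suff -> : z = - \sum_i (\sum_l a l * X l i) ^+ 2 by rewrite subr_ge0.
  rewrite /z -sumrN; apply: eq_bigr => i _; rewrite -mulr_suml.
  have -> : \sum_l a l * X l i = (\sum_l a l * Hxp l i) / sg i.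
    by rewrite mulr_suml; apply: eq_bigr => l _; rewrite mulrA.
  set T := \sum_l _; have [vi|vi] := eqVneq (v i) 0.
    by rewrite /sg vi sqrtr0 invr0 !mulr0 expr0n /=; ring.
  have sv : sg i ^+ 2 = v i by rewrite /sg sqr_sqrtr.
  have sn : sg i != 0 by rewrite -sqrf_eq0 sv.
  by rewrite -sv; field.
have hbk k : ball (p k) (X k).
  rewrite /ball; apply: le_trans (h5 k); have := schur (fun l => (l == k)%:R).
  have e (f : 'I_K -> R) : \sum_l (l == k)%:R * f l = f k.
    rewrite (bigD1 k) //= eqxx mul1r big1 ?addr0 // => l /negPf ->; exact: mul0r.
  under eq_bigr => i _ do rewrite e.
  suff -> : \sum_i \sum_j (i == k)%:R * Hxx i j * (j == k)%:R = Hxx k k by [].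
  under eq_bigr => i _.
    under eq_bigr => j _ do rewrite mulrC.
    rewrite e; over.
  exact: e.
have hy k : y k = m k * p k + sg k * X k k.
  have := h3 k; suff -> : Hxp k k = sg k * X k k by lra.
  have [vi|vi] := eqVneq (v k) 0; last first.
    rewrite /X mulrCA divff ?mulr1 // /sg sqrtr_eq0 -ltNge.
    by rewrite lt_neqAle eq_sym vi v_ge0.
  (* When [v k = 0], a nonzero [Hxp k k] would let the test vector below give the form the value
     -1. *)
  rewrite /sg vi sqrtr0 mul0r; apply/eqP/negPn/negP => hn.
  have := @psd_form Hxx Hxp Hpp (fun l => (l == k)%:R)
     (fun l => (l == k)%:R * (- (Hxx k k + 1) / (2 * Hxp k k))) h7 h4.
  have e (f : 'I_K -> R) : \sum_l (l == k)%:R * f l = f k.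
    rewrite (bigD1 k) //= eqxx mul1r big1 ?addr0 // => l /negPf ->; exact: mul0r.
  have e2 (H : 'M[R]_K) (f : 'I_K -> R) : \sum_i \sum_j (i == k)%:R * H i j * f j = \sum_j H k j * f j.
    transitivity (\sum_i (i == k)%:R * \sum_j H i j * f j); last exact: e.
    by apply: eq_bigr => i _; rewrite mulr_sumr; apply: eq_bigr => j _; rewrite mulrA.
  rewrite !e2.
  have -> : \sum_i v i * ((i == k)%:R * (- (Hxx k k + 1) / (2 * Hxp k k))) ^+ 2 = 0.
    rewrite big1 // => i _; have [->|_] := eqVneq i k; first by rewrite vi mul0r.
    by rewrite mul0r expr0n mulr0.
  under eq_bigr => j _ do rewrite mulrC.
  under [X in _ + _ * X + _]eq_bigr => j _ do rewrite mulrCA.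
  rewrite !e.
  have -> : 2 * (Hxp k k * (- (Hxx k k + 1) / (2 * Hxp k k))) = - (Hxx k k + 1) by field.
  by lra.
exists p, X; split=> [k|].
  have [r0 [hr _]] := h1 k; split => //.
  exact/(rate_okP r0 (hbk k) (hy k)).
rewrite /ball; apply: le_trans h6; have := schur (fun=> 1).
under eq_bigr => i _ do under eq_bigr do rewrite mul1r.
by under [X in _ <= X -> _]eq_bigr => i _ do under eq_bigr do rewrite mul1r mulr1.
Qed.

(** The witness is the Gram matrix of the rows of X stacked on the diagonal matrix of [sg]. *)
Lemma policy_inG p X r : policy c m sg p X r -> inG D0 B m v r.
Proof.
move=> [h hb].
have hs k := h k; have P01 := ball_prob hb.
set Xm : 'M[R]_K := \matrix_(l, i) X l i.
set V : 'M[R]_K := \matrix_(l, i) (if l == i then sg i else 0).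
have XVe l i : (Xm *m V^T) l i = X l i * sg i.
  rewrite mxE (bigD1 i) //= !mxE eqxx big1 ?addr0 // => j ji.
  by rewrite !mxE eq_sym (negPf ji) mulr0.
exists p, (fun k => m k * p k + sg k * X k k), (Xm *m Xm^T), (Xm *m V^T), (V *m V^T).
split; [|split; [|split; [|split; [|split; [|split]]]]].
- move=> k; have [r0 hr hbk] := hs k; split => //; split; last exact: ball_prob hbk.
  exact/(rate_okP r0 hbk erefl).
- by lra.
- by move=> k; rewrite XVe; ring.
- move=> i j; rewrite mxE (bigD1 j) //= !mxE eqxx big1 => [|l lj]; last first.
    by rewrite !mxE [j == l]eq_sym (negPf lj) mulr0.
  case: eqP => [->|_]; last by rewrite mul0r addr0.
  by rewrite addr0 -expr2 /sg sqr_sqrtr.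
- move=> k; have [_ _ hbk] := hs k; apply: le_trans hbk; rewrite mxE.
  by apply: ler_sum => i _; rewrite !mxE expr2.
- apply: le_trans hb.
  rewrite [X in _ <= X](_ : _ = \sum_i \sum_j (Xm *m Xm^T) i j) //.
  under eq_bigr => i _ do rewrite expr2 mulr_suml.
  rewrite exchange_big /=; apply: eq_bigr => l _.
  under eq_bigr => i _ do rewrite mulr_sumr.
  rewrite exchange_big /=; apply: eq_bigr => j _; rewrite mxE.
  by apply: eq_bigr => i _; rewrite !mxE.
- have -> : block_mx (Xm *m Xm^T) (Xm *m V^T) (Xm *m V^T)^T (V *m V^T) =
     col_mx Xm V *m (col_mx Xm V)^T.
    by rewrite tr_col_mx mul_col_row trmx_mul trmxK.
  split=> [|x]; first by rewrite trmx_mul trmxK.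
  rewrite mulmxA -mulmxA -[x^T *m _]trmxK trmx_mul trmxK.
  set z := _ *m x; rewrite mxE; apply: sumr_ge0 => i _.
  by rewrite !mxE -expr2 sqr_ge0.
Qed.

(* First-order optimality of rs for the concave objective over the convex set. *)
Lemma argmax_f_le rs r : is_argmax_f (inG D0 B m v) rs -> inG D0 B m v r ->
  \sum_k r k / rs k <= K%:R.
Proof.
move=> [/inG_policy[ps [Xs hs]] rs0 hmax] /inG_policy[p [X hp]].
have r0 k : 0 <= r k by have [] := hp.1 k.
set d := fun k => r k / rs k - 1.
have d1 k : -1 <= d k.
  rewrite /d; suff : 0 <= r k / rs k by lra.
  by rewrite divr_ge0 // ltW.
suff : \sum_k d k <= 0.
  by rewrite /d sumrB sumr_const card_ord subr_le0.
(* Optimality against the point at parameter [t], with ln (1 + u) >= u - 2 u^2 for u >= -1/2. *)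
have key t : 0 < t -> t <= 1 / 2 -> \sum_k d k <= 2 * t * \sum_k d k ^+ 2.
  move=> t0 t2; have t01 : 0 <= t <= 1 by lra.
  have hG := policy_inG (policy_conv t01 hs hp).
  have e k : (1 - t) * rs k + t * r k = rs k * (1 + t * d k).
    by rewrite /d; field; exact: lt0r_neq0.
  have pos k : 0 < 1 + t * d k by have := d1 k; nra.
  have hpos k : 0 < (1 - t) * rs k + t * r k by rewrite e mulr_gt0.
  have := hmax _ hG hpos.
  rewrite /f_obj; under eq_bigr => k _ do rewrite e lnM ?posrE //.
  rewrite big_split /= -lerBrDl subrr => hln.
  rewrite -(ler_pM2l t0); apply: le_trans (_ : _ <= t * (2 * t * \sum_k d k ^+ 2) + \sum_k ln (1 + t * d k)) _; last by lra.
  rewrite !mulr_sumr -big_split /=; apply: ler_sum => k _.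
  have := @ln_le_tangent R 1 (1 + t * d k) ltr01 (pos k); rewrite ln1 div1r.
  suff : (1 + t * d k)^-1 <= 1 - t * d k + 2 * (t * d k) ^+ 2 by lra.
  have h2 : 1 / 2 <= 1 + t * d k by have := d1 k; nra.
  rewrite -[_^-1]mul1r ler_pdivrMr //.
  have : 0 <= (t * d k) ^+ 2 * (2 * (1 + t * d k) - 1) by rewrite mulr_ge0 ?sqr_ge0 //; lra.
  by lra.
rewrite leNgt; apply/negP => hd.
set Q := \sum_k d k ^+ 2 in key.
have Q0 : 0 <= Q by rewrite sumr_ge0 // => k _; exact: sqr_ge0.
set s := \sum_k d k in hd key.
(* At this [t] the bound 2 t Q of [key] is at most s / 2, which is absurd for s > 0. *)
have t0 : 0 < s / (4 * (Q + s)) by rewrite divr_gt0 //; lra.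
have te : s / (4 * (Q + s)) * (4 * (Q + s)) = s by rewrite divfK //; lra.
have t2 : s / (4 * (Q + s)) <= 1 / 2 by rewrite ler_pdivrMr; lra.
by have := key _ t0 t2; nra.
Qed.

End Feasible.

(** * One iteration as a normalized step *)

Section Step.
Variables (R : realType) (K : nat).

Lemma vmin_le (a : 'I_K -> R) k : vmin a <= a k.
Proof. exact: bigmin_le. Qed.

Lemma vmin_attained (a : 'I_K -> R) : (0 < K)%N -> exists k, vmin a = a k.
Proof.
move=> K0; rewrite /vmin; apply: (big_ind (fun x => exists k, x = a k)).
- have : (0 < size (enum 'I_K))%N by rewrite size_enum_ord.
  by case: (enum 'I_K) => // k s _; exists k.
- by move=> x y [k ->] [l ->]; rewrite minEle; case: ifP => _; [exists k | exists l].
- by move=> k _; exists k.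
Qed.

Lemma norm2_sqr (a : 'I_K -> R) : norm2 a ^+ 2 = \sum_k a k ^+ 2.
Proof. by rewrite /norm2 sqr_sqrtr // sumr_ge0 // => k _; exact: sqr_ge0. Qed.

(* One iteration is a normalized step against d = ri - rs, of length e = 1 / (a + b). *)
Lemma w_next_step (w ri rs : 'I_K -> R) : (0 < K)%N -> (forall k, 0 < w k) ->
  \sum_k w k ^+ 2 = 1 -> 0 < dotv w (vsub ri rs) ->
  (forall k, 0 < w_next w ri rs k) /\ \sum_k w_next w ri rs k ^+ 2 = 1 /\
  exists e nu, [/\ 0 < e, 0 < nu,
    forall k, w_next w ri rs k * nu = w k - e * vsub ri rs k,
    1 - 2 * dotv w (vsub ri rs) * e <= nu ^+ 2 <= 1 - dotv w (vsub ri rs) * e &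
    exists k, e^-1 = (\sum_k vsub ri rs k ^+ 2) / dotv w (vsub ri rs) + vsub ri rs k / w k].
Proof.
move=> K0 w0 w1; set s := dotv w (vsub ri rs) => s0.
set Q := \sum_k vsub ri rs k ^+ 2.
have Qs : s ^+ 2 <= Q.
  have : 0 <= \sum_k (vsub ri rs k - s * w k) ^+ 2.
    by rewrite sumr_ge0 // => k _; exact: sqr_ge0.
  have -> : \sum_k (vsub ri rs k - s * w k) ^+ 2 = Q - 2 * s * s + s ^+ 2 * 1.
    transitivity (Q - 2 * s * (\sum_k w k * vsub ri rs k) + s ^+ 2 * \sum_k w k ^+ 2).
      rewrite /Q [2 * s * _]mulr_sumr [s ^+ 2 * _]mulr_sumr -sumrB -big_split /=.
      by apply: eq_bigr => k _; ring.
    by rewrite w1.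
  by lra.
have Q0 : 0 < Q by apply: lt_le_trans Qs; rewrite exprn_gt0.
have Qe : norm2 (vsub rs ri) ^+ 2 = Q.
  by rewrite norm2_sqr; apply: eq_bigr => k _; rewrite /vsub; ring.
rewrite /w_next Qe -/s.
set a := Q / s; set b := - vmin _.
have a0 : 0 < a by rewrite divr_gt0.
(* [b] is the largest ratio d_k / w_k; averaging with weights w_k^2 gives s <= b, hence a + b >
   0. *)
have bw k : vsub ri rs k <= b * w k.
  have := vmin_le (fun k => (rs k - ri k) / w k) k; rewrite ler_pdivlMr // -/b.
  have -> : vmin (fun k => (rs k - ri k) / w k) = - b by rewrite /b opprK.
  by rewrite /vsub; lra.
have bs : s <= b.
  rewrite -[b]mulr1 -w1 mulr_sumr /s /dotv; apply: ler_sum => k _.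
  by have := ler_wpM2l (ltW (w0 k)) (bw k); lra.
set u := fun k => (a + b) * w k + (rs k - ri k).
have u0 k : 0 < u k.
  have : 0 < a * w k by rewrite mulr_gt0.
  by have := bw k; rewrite /u /vsub; lra.
have ue : norm2 u ^+ 2 = (a + b) ^+ 2 - 2 * (a + b) * s + Q.
  transitivity ((a + b) ^+ 2 * (\sum_k w k ^+ 2) -
      2 * (a + b) * (\sum_k w k * vsub ri rs k) + Q); last by rewrite w1 mulr1.
  rewrite norm2_sqr [(a + b) ^+ 2 * _]mulr_sumr [2 * (a + b) * _]mulr_sumr -sumrB -big_split /=.
  by apply: eq_bigr => k _; rewrite /u /vsub; ring.
have up : 0 < norm2 u.
  rewrite sqrtr_gt0; case: K K0 u u0 {ue} => // n _ u u0.
  by rewrite big_ord_recl ltr_pwDl ?exprn_gt0 // sumr_ge0 // => k _; exact: sqr_ge0.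
have ab : 0 < a + b by lra.
rewrite -/u; split; first by move=> k; exact: divr_gt0 (u0 k) up.
split.
  under eq_bigr => k _ do rewrite exprMn.
  by rewrite -mulr_suml -norm2_sqr -exprMn divff ?expr1n // lt0r_neq0.
exists (a + b)^-1, (norm2 u / (a + b)).
have un := lt0r_neq0 up; have abn := lt0r_neq0 ab.
split.
- by rewrite invr_gt0.
- by rewrite divr_gt0.
- by move=> k; rewrite mulrA divfK // /u /vsub; field.
- rewrite exprMn ue; have -> : Q = a * s by rewrite divfK // lt0r_neq0.
  (* Thus nu^2 = 1 - 2 s e + (a e)(s e), and 0 <= a e <= 1 gives both bounds. *)
  have -> : ((a + b) ^+ 2 - 2 * (a + b) * s + a * s) * (a + b)^-1 ^+ 2 =
     1 - 2 * s * (a + b)^-1 + a * (a + b)^-1 * (s * (a + b)^-1) by field.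
  set e := (a + b)^-1.
  have e0 : 0 < e by rewrite invr_gt0.
  have ae : 0 <= a * e <= 1.
    have be : 0 < b * e by rewrite mulr_gt0 //; lra.
    have : 0 < a * e by rewrite mulr_gt0.
    by have : (a + b) * e = 1; [rewrite divff | lra].
  have se : 0 < s * e by rewrite mulr_gt0.
  apply/andP; split; nra.
- have [k hk] := vmin_attained (fun k => (rs k - ri k) / w k) K0.
  by exists k; rewrite invrK /b hk /vsub; ring.
Qed.

End Step.

(** * Limit of the weights when the algorithm never stops *)

Section Trajectory.
Variables (R : realType) (K : nat).

Lemma bounded_nondecreasing_limit (f : nat -> R) M : (forall n, f n <= f n.+1) ->
  (forall n, f n <= M) ->
  exists l, forall de, 0 < de -> exists n, forall i, (n <= i)%N -> `|f i - l| <= de.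
Proof.
move=> f1 fM; pose A : set R := range f.
have fm i j : (i <= j)%N -> f i <= f j.
  elim: j => [|j IH]; first by rewrite leqn0 => /eqP ->.
  by rewrite leq_eqVlt => /orP[/eqP -> //|/IH h]; exact: le_trans h (f1 j).
have hA : has_sup A.
  by split; [exists (f 0%N), 0%N | exists M => _ [n _ <-]].
exists (sup A) => de de0.
have [_ [n _ <-] hn] := sup_adherent de0 hA.
exists n => i ni; have h1 : f i <= sup A by apply: ub_le_sup; [case: hA | exists i].
by have := fm _ _ ni; rewrite ler_distlC; lra.
Qed.

(** Both L times the partial sums of [e] and [f] plus that quantity are nondecreasing and bounded;
    [f] is their difference. *)
Lemma summable_increments_limit (f e : nat -> R) L M : (forall n, 0 <= e n) -> 0 <= L ->
  (forall n, \sum_(i < n) e i <= M) -> (forall n, `|f n.+1 - f n| <= L * e n) ->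
  (forall n, f n <= 1) ->
  exists l, forall de, 0 < de -> exists n, forall i, (n <= i)%N -> `|f i - l| <= de.
Proof.
move=> e0 L0 eM fL f1; set H := fun n => L * \sum_(i < n) e i.
have HS n : H n.+1 = H n + L * e n by rewrite /H big_ord_recr /= mulrDr.
have HM n : H n <= L * M by rewrite /H ler_wpM2l.
have [l1 h1] := @bounded_nondecreasing_limit H (L * M) (fun n => ltac:(by rewrite HS lerDl mulr_ge0)) HM.
have [n|n|l2 h2] := @bounded_nondecreasing_limit (fun n => f n + H n) (1 + L * M).
- by have := fL n; rewrite HS ler_norml; lra.
- by rewrite lerD.
exists (l2 - l1) => de de0; have de2 : 0 < de / 2 by lra.
have [n1 {}h1] := h1 _ de2; have [n2 {}h2] := h2 _ de2.
exists (maxn n1 n2) => i; rewrite geq_max => /andP[i1 i2].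
have := h1 _ i1; have := h2 _ i2; rewrite !ler_norml; lra.
Qed.

Variables (w d : nat -> 'I_K -> R) (e nu : nat -> R) (g : 'I_K -> R) (eps C : R) (ku : 'I_K).
Hypotheses (w_gt0 : forall i k, 0 < w i k) (w_unit : forall i, \sum_k w i k ^+ 2 = 1).
Hypotheses (eps_gt0 : 0 < eps) (s_ge : forall i, eps <= dotv (w i) (d i)).
Hypothesis g_gt0 : forall k, 0 < g k.
Hypothesis gd_le0 : forall i, \sum_k g k * d i k <= 0.
Hypothesis d_le : forall i k, `|d i k| <= C.
Hypotheses (e_gt0 : forall i, 0 < e i) (nu_gt0 : forall i, 0 < nu i).
Hypothesis stepE : forall i k, w i.+1 k * nu i = w i k - e i * d i k.
Hypothesis nu_bounds : forall i,
  1 - 2 * dotv (w i) (d i) * e i <= nu i ^+ 2 <= 1 - dotv (w i) (d i) * e i.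
Hypothesis eV : forall i, exists k,
  (e i)^-1 = (\sum_k d i k ^+ 2) / dotv (w i) (d i) + d i k / w i k.

Let s i := dotv (w i) (d i).

Lemma traj_le1 i k : w i k <= 1.
Proof.
have := w_unit i; rewrite (bigD1 k) //=.
have : 0 <= \sum_(j < K | j != k) w i j ^+ 2 by rewrite sumr_ge0 // => j _; exact: sqr_ge0.
by have := w_gt0 i k; nra.
Qed.

Lemma traj_s_gt0 i : 0 < s i.
Proof. exact: lt_le_trans eps_gt0 (s_ge i). Qed.

Lemma traj_nu_le1 i : nu i <= 1.
Proof.
have := nu_bounds i; have := traj_s_gt0 i; rewrite -/(s i) => h /andP[_].
have : 0 < s i * e i by rewrite mulr_gt0.
by have := nu_gt0 i; nra.
Qed.

Lemma traj_C_ge0 : 0 <= C.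
Proof. by apply: le_trans (d_le 0%N ku). Qed.

Lemma traj_s_le i : s i <= K%:R * C.
Proof.
rewrite /s /dotv mulr_natl -[in X in _ <= X](card_ord K) -sumr_const.
apply: ler_sum => k _; have := d_le i k; have := w_gt0 i k; have := traj_le1 i k.
by rewrite ler_norml; nra.
Qed.

(* <g, w i> grows by a factor at least 1 + s e / 2 at each step, and is bounded. *)
Lemma traj_summable : exists M, forall n, \sum_(i < n) e i <= M.
Proof.
set ps := fun i => \sum_k g k * w i k.
have ps0 i : 0 < ps i.
  rewrite /ps (bigD1 ku) //= ltr_pwDl ?mulr_gt0 // sumr_ge0 // => j _.
  by rewrite mulr_ge0 // ltW.
have psS i : ps i <= ps i.+1 * nu i.
  rewrite /ps mulr_suml; have := gd_le0 i => h.
  have -> : \sum_k g k * w i.+1 k * nu i = \sum_k g k * w i k - e i * \sum_k g k * d i k.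
    by rewrite mulr_sumr -sumrB; apply: eq_bigr => k _; rewrite -mulrA stepE; ring.
  have : 0 <= e i * - (\sum_k g k * d i k) by rewrite mulr_ge0 ?oppr_ge0 // ltW.
  by lra.
have mono i : ps i <= ps i.+1.
  by apply: le_trans (psS i) _; rewrite ger_pMr // traj_nu_le1.
have mono0 i : ps 0%N <= ps i by elim: i => // i IH; exact: le_trans IH (mono i).
have nuS i : nu i <= 1 - s i * e i / 2.
  have /andP[_ h] := nu_bounds i; rewrite -/(s i) in h.
  have h2 : 0 < nu i ^+ 2 by rewrite exprn_gt0.
  have h3 : nu i ^+ 2 <= (1 - s i * e i / 2) ^+ 2 by have := sqr_ge0 (s i * e i); lra.
  rewrite -(@ler_pXn2r _ 2) ?nnegrE //; [exact: ltW | by lra].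
have key i : ps i + ps 0%N * eps / 2 * e i <= ps i.+1.
  have h1 : ps i <= ps i.+1 * (1 - s i * e i / 2).
    by apply: le_trans (psS i) _; rewrite ler_pM2l.
  have h2 : ps 0%N * eps <= ps i.+1 * s i.
    by apply: ler_pM; [exact: ltW | exact: ltW | exact: mono0 | exact: s_ge].
  have := ler_wpM2r (ltW (e_gt0 i)) h2; lra.
have sum n : ps 0%N + ps 0%N * eps / 2 * \sum_(i < n) e i <= ps n.
  elim: n => [|n IH]; first by rewrite big_ord0 mulr0 addr0.
  by rewrite big_ord_recr /=; have := key n; lra.
exists (\sum_k g k / (ps 0%N * eps / 2)) => n.
have c0 : 0 < ps 0%N * eps / 2 by rewrite divr_gt0 // mulr_gt0.
rewrite -mulr_suml ler_pdivlMr //.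
have : ps n <= \sum_k g k.
  by apply: ler_sum => k _; rewrite ler_piMr ?traj_le1 // ltW.
by have := sum n; have := ps0 0%N; lra.
Qed.

(** The normalization contributes 1 - nu <= 1 - nu^2 <= 2 s e, the step itself at most C e. *)
Lemma traj_increment i k : `|w i.+1 k - w i k| <= (2 * (K%:R * C) + C) * e i.
Proof.
have -> : w i.+1 k - w i k = (1 - nu i) * w i.+1 k - e i * d i k.
  by have := stepE i k; lra.
have n1 := traj_nu_le1 i; have n0 := nu_gt0 i.
have /andP[h _] := nu_bounds i; rewrite -/(s i) in h.
have h1 : 1 - nu i <= 2 * s i * e i by nra.
have h2 : s i * e i <= K%:R * C * e i by rewrite ler_pM2r ?traj_s_le.
have h3 : 0 <= (1 - nu i) * w i.+1 k <= 1 - nu i.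
  rewrite mulr_ge0 ?subr_ge0 //=; last exact: ltW.
  by rewrite ler_piMr ?traj_le1 // subr_ge0.
have h4 : `|e i * d i k| <= C * e i.
  by rewrite normrM gtr0_norm // mulrC ler_pM2r.
by move: h4; rewrite !ler_norml; lra.
Qed.

Lemma traj_limit : exists W : 'I_K -> R, forall k de, 0 < de ->
  exists n, forall i, (n <= i)%N -> `|w i k - W k| <= de.
Proof.
have [M hM] := traj_summable.
have L0 : 0 <= 2 * (K%:R * C) + C by have := traj_C_ge0 => ?; rewrite addr_ge0 // mulr_ge0 // mulr_ge0.
have h k := @summable_increments_limit (fun i => w i k) e _ M (fun i => ltW (e_gt0 i)) L0 hM
  (fun i => traj_increment i k) (fun i => traj_le1 i k).
by have [W hW] := choice h; exists W.
Qed.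

Lemma traj_limit_uniform (W : 'I_K -> R) :
  (forall k de, 0 < de -> exists n, forall i, (n <= i)%N -> `|w i k - W k| <= de) ->
  forall de, 0 < de -> exists n, forall i k, (n <= i)%N -> `|w i k - W k| <= de.
Proof.
move=> h de de0; have [N hN] := choice (fun k => h k de de0).
exists (\max_k N k) => i k; move=> hi; apply: hN; apply: leq_trans hi.
exact: leq_bigmax.
Qed.

(** With all limit weights positive, [eV] would bound 1/e by a constant [Y] from some index on, and
    the step lengths would not be summable. *)
Lemma traj_limit_vanishes (W : 'I_K -> R) :
  (forall k de, 0 < de -> exists n, forall i, (n <= i)%N -> `|w i k - W k| <= de) ->
  (forall k, 0 <= W k) -> exists k, W k = 0.
Proof.
move=> hW W0; apply/not_existsP => Wn.
have Wp k : 0 < W k by rewrite lt_neqAle W0 andbT eq_sym; apply/eqP/Wn.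
have C0 := traj_C_ge0.
set z := \sum_k (W k)^-1.
have zk k : (W k)^-1 <= z.
  by rewrite /z (bigD1 k) //= lerDl sumr_ge0 // => j _; rewrite invr_ge0.
have z0 : 0 < z by apply: lt_le_trans (zk ku); rewrite invr_gt0.
have Wz k : z^-1 <= W k by rewrite -[W k]invrK lef_pV2 ?posrE ?invr_gt0.
have zV : 0 < z^-1 by rewrite invr_gt0.
have [n hn] := traj_limit_uniform hW (ltac:(lra) : 0 < z^-1 / 2).
have wz i k : (n <= i)%N -> (w i k)^-1 <= 2 * z.
  move=> /(hn _ k); rewrite ler_norml => h.
  have -> : 2 * z = (z^-1 / 2)^-1 by rewrite invfM !invrK mulrC.
  by rewrite lef_pV2 ?posrE //; [have := Wz k; lra | lra].
set Y := K%:R * C ^+ 2 / eps + C * (2 * z) + 1.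
have eY i : (n <= i)%N -> (e i)^-1 <= Y.
  move=> ni; have [k ->] := eV i; rewrite /Y.
  have h1 : (\sum_k d i k ^+ 2) / dotv (w i) (d i) <= K%:R * C ^+ 2 / eps.
    apply: ler_pM; first by rewrite sumr_ge0 // => j _; exact: sqr_ge0.
    - by rewrite invr_ge0 ltW // traj_s_gt0.
    - rewrite mulr_natl -[in X in _ <= X](card_ord K) -sumr_const; apply: ler_sum => j _.
      by rewrite -real_normK ?num_real // ler_pXn2r ?nnegrE.
    - by rewrite lef_pV2 ?posrE // traj_s_gt0.
  have h2 : d i k / w i k <= C * (2 * z).
    have hd : d i k <= C by apply: le_trans (d_le i k); exact: ler_norm.
    have wV : 0 < (w i k)^-1 by rewrite invr_gt0.
    apply: le_trans (_ : _ <= C * (w i k)^-1) _; first by rewrite ler_pM2r.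
    by apply: ler_wpM2l => //; exact: wz.
  by lra.
have Y0 : 0 < Y by apply: lt_le_trans (eY n (leqnn n)); rewrite invr_gt0.
have [M hM] := traj_summable.
have lb j : j%:R / Y <= \sum_(i < n + j) e i.
  elim: j => [|j IH].
    by rewrite mul0r sumr_ge0 // => i _; exact: ltW.
  rewrite addnS big_ord_recr /= -natr1 mulrDl mul1r; apply: lerD => //.
  by rewrite -[e _]invrK lef_pV2 ?posrE ?invr_gt0 // eY // leq_addr.
have [j hj] : exists j : nat, M * Y < j%:R.
  exists (Num.bound `|M * Y|).
  exact: le_lt_trans (ler_norm _) (archi_boundP (normr_ge0 _)).
by have := le_trans (lb j) (hM _); rewrite ler_pdivrMr // leNgt hj.
Qed.

(** On the vanishing users the weighted sum [ps] is positive and tends to 0; were the last sum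
    negative from some index on, [ps] would be nondecreasing from there. *)
Lemma traj_escape : exists W : 'I_K -> R, [/\ forall k, 0 <= W k, exists k, W k = 0,
  forall k de, 0 < de -> exists n, forall i, (n <= i)%N -> `|w i k - W k| <= de &
  forall n, exists2 i, (n <= i)%N & 0 <= \sum_(k | W k == 0) g k * d i k].
Proof.
have [W hW] := traj_limit; exists W.
have W0 k : 0 <= W k.
  rewrite leNgt; apply/negP => Wk; have [n hn] := hW k (- W k / 2) ltac:(lra).
  by have := hn n (leqnn n); have := w_gt0 n k; rewrite ler_norml; lra.
split => // [|n]; first exact: traj_limit_vanishes hW W0.
apply/not_exists2P => hno.
have hd i : (n <= i)%N -> \sum_(k | W k == 0) g k * d i k <= 0.
  by move=> ni; rewrite leNgt; apply/negP => h; case: (hno i) => [|/negP]; [move/negP; rewrite ni | rewrite ltW].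
have [k0 Wk0] := traj_limit_vanishes hW W0.
set ps := fun i => \sum_(k | W k == 0) g k * w i k.
have ps0 : 0 < ps n.
  rewrite /ps (bigD1 k0) /=; last by rewrite Wk0.
  by rewrite ltr_pwDl ?mulr_gt0 // sumr_ge0 // => k _; rewrite mulr_ge0 // ltW.
have mono i : (n <= i)%N -> ps i <= ps i.+1.
  move=> ni; apply: le_trans (_ : _ <= ps i.+1 * nu i) _; last first.
    by rewrite ler_piMr ?traj_nu_le1 // sumr_ge0 // => k _; rewrite mulr_ge0 // ltW.
  rewrite /ps mulr_suml.
  have -> : \sum_(k | W k == 0) g k * w i.+1 k * nu i =
     \sum_(k | W k == 0) g k * w i k - e i * \sum_(k | W k == 0) g k * d i k.
    by rewrite mulr_sumr -sumrB; apply: eq_bigr => k _; rewrite -mulrA stepE; ring.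
  have : 0 <= e i * - (\sum_(k | W k == 0) g k * d i k).
    by rewrite mulr_ge0 ?oppr_ge0 ?hd // ltW.
  by lra.
have mono' j : ps n <= ps (n + j)%N.
  by elim: j => [|j IH]; rewrite ?addn0 // addnS; apply: le_trans IH (mono _ (leq_addr _ _)).
set G := \sum_k g k.
have G0 : 0 < G.
  by rewrite /G (bigD1 k0) //= ltr_pwDl // sumr_ge0 // => k _; exact: ltW.
have de0 : 0 < ps n / (2 * G) by rewrite divr_gt0 // mulr_gt0.
have [n' hn'] := traj_limit_uniform hW de0.
have hps : ps (n + n')%N <= G * (ps n / (2 * G)).
  rewrite /G mulr_suml -/G; apply: le_trans (_ : _ <= \sum_(k | W k == 0) g k * (ps n / (2 * G))) _.
    apply: ler_sum => k /eqP Wk; rewrite ler_pM2l //.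
    have := hn' (n + n')%N k (leq_addl _ _); rewrite Wk subr0.
    by apply: le_trans; exact: ler_norm.
  rewrite [X in _ <= X](bigID (fun k => W k == 0)) /= lerDl sumr_ge0 // => k _.
  by rewrite mulr_ge0 // ltW.
have e2 : G * (ps n / (2 * G)) = ps n / 2 by field; rewrite lt0r_neq0.
by have := mono' n'; lra.
Qed.

End Trajectory.

(** * Limits of bounded sequences along an ultrafilter *)

Section UltraLimit.
Variables (R : realType) (U : set_system nat).
Context {UU : UltraFilter U}.

Local Open Scope classical_set_scope.

(** One ultrafilter serves all coordinates at once, in place of successive subsequences. The limit
    is the supremum of the levels that f reaches on a set of [U]. *)
Lemma ultra_bounded_cvg (f : nat -> R) (C : R) : (forall n, `|f n| <= C) ->
  exists l : R, f n @[n --> U] --> l.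
Proof.
move=> fC; have UP : ProperFilter U := ultra_proper.
set A := [set x : R | U [set n | x <= f n]].
have hA : has_sup A.
  split; first by exists (- C); apply: filterE => n; have := fC n; rewrite ler_norml => /andP[].
  exists C => x /= hx; have [n hn] := filter_ex hx.
  by apply: le_trans hn _; apply: le_trans (fC n); exact: ler_norm.
exists (sup A); apply/cvgrPdist_lt => e e0.
have [x Ax hx] := sup_adherent e0 hA.
have e2 : 0 < e / 2 by rewrite divr_gt0.
have nA : ~ A (sup A + e / 2).
  by move=> /(ub_le_sup hA.2); lra.
have [//|hU] := in_ultra_setVsetC [set n | sup A + e / 2 <= f n] UU.
near=> n.
have h1 : x <= f n by near: n.
have h2 : f n < sup A + e / 2 by rewrite ltNge; apply/negP; near: n.
by rewrite ltr_distlC; lra.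
Unshelve. all: by end_near. Qed.

Lemma cvg_sumU (I : finType) (P : pred I) (f : I -> nat -> R) (l : I -> R) :
  (forall i, f i n @[n --> U] --> l i) ->
  \sum_(i | P i) f i n @[n --> U] --> \sum_(i | P i) l i.
Proof.
have UP : ProperFilter U := ultra_proper.
by move=> h; apply: cvg_big => [|i _]; [exact: add_continuous | exact: h].
Qed.

Lemma le_cvgU (f g : nat -> R) (a b : R) : f n @[n --> U] --> a -> g n @[n --> U] --> b ->
  (forall n, f n <= g n) -> a <= b.
Proof.
have UP : ProperFilter U := ultra_proper.
by move=> hf hg h; apply: (ler_cvg_to hf hg); apply: nearW.
Qed.

End UltraLimit.

(** * Compactness of the set of policies *)

Section PolicyLimit.
Variables (R : realType) (K : nat) (c : R) (m sg : 'I_K -> R).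
Hypotheses (c_gt0 : 0 < c) (m_ge0 : forall k, 0 <= m k).
Hypothesis sg_ge0 : forall k, 0 <= sg k.
Variables (U : set_system nat).
Context {UU : UltraFilter U}.
Variables (p r : nat -> 'I_K -> R) (X : nat -> 'I_K -> 'I_K -> R).
Hypothesis hp : forall n, policy c m sg (p n) (X n) (r n).

Local Open Scope classical_set_scope.

(** All data are bounded and every constraint is a nonstrict polynomial inequality for each fixed
    [s]; the tangent form involves no division by a probability that may tend to 0. *)
Lemma policy_ultralimit : exists p' X' r',
  policy c m sg p' X' r' /\ forall k, r n k @[n --> U] --> r' k.
Proof.
have UP : ProperFilter U := ultra_proper.
have cr k : exists l : R, r n k @[n --> U] --> l.
  apply: (@ultra_bounded_cvg _ _ _ _ (c * (m k + sg k))) => n.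
  by have := policy_rate_le c_gt0 m_ge0 sg_ge0 k (hp n); rewrite ler_norml; lra.
have cp k : exists l : R, p n k @[n --> U] --> l.
  apply: (@ultra_bounded_cvg _ _ _ _ 1) => n; have [_ _ /ball_prob] := (hp n).1 k.
  by rewrite ler_norml; lra.
have cX (ki : 'I_K * 'I_K) : exists l : R, X n ki.1 ki.2 @[n --> U] --> l.
  apply: (@ultra_bounded_cvg _ _ _ _ 1) => n; have [_ _ /(ball_norm ki.2)] := (hp n).1 ki.1.
  by rewrite ler_norml.
have [r' hr] := choice cr; have [p' hp'] := choice cp; have [X0 hX] := choice cX.
pose X' k i := X0 (k, i); have hX' k i : X n k i @[n --> U] --> X' k i by exact: (hX (k, i)).
have hball (q : nat -> R) (x : nat -> 'I_K -> R) q' x' : (forall n, ball (q n) (x n)) ->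
    q n @[n --> U] --> q' -> (forall i, x n i @[n --> U] --> x' i) -> ball q' x'.
  move=> hb hq hx; rewrite /ball; apply: (le_cvgU _ _ hb).
    by apply: cvg_sumU => i; rewrite expr2; exact: cvgM.
  by apply: cvgB => //; rewrite expr2; exact: cvgM.
exists p', X', r'; split => //; split=> [k|].
  split.
  - by apply: (@le_cvgU _ _ _ (fun=> 0) _ _ _ (cvg_cst _) (hr k)) => n; have [] := (hp n).1 k.
  - move=> s s0; pose f n := c * (p n k * (ln s - 1) + (p n k + (m k * p n k + sg k * X n k k)) / s).
    apply: (@le_cvgU _ _ _ (r ^~ k) f _ _ (hr k)) => [|n]; last by have [_ h _] := (hp n).1 k; exact: h.
    apply: cvgM; first exact: cvg_cst.
    apply: cvgD; first by apply: cvgM => //; exact: cvg_cst.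
    apply: cvgM; last exact: cvg_cst.
    apply: cvgD => //; apply: cvgD; apply: cvgM => //; exact: cvg_cst.
  - by apply: (hball (p ^~ k) (fun n => X n k)) => // n; have [] := (hp n).1 k.
apply: (hball (fun n => \sum_k p n k) (fun n i => \sum_k X n k i)).
- by move=> n; exact: (hp n).2.
- exact: cvg_sumU.
- by move=> i; apply: cvg_sumU => k; exact: hX'.
Qed.

End PolicyLimit.

(** * Convergence of the algorithm *)

Lemma dotv_vsub (R : realType) (K : nat) (w a b : 'I_K -> R) :
  dotv w (vsub a b) = dotv w a - dotv w b.
Proof. by rewrite /dotv -sumrB; apply: eq_bigr => k _; rewrite mulrBr. Qed.

Theorem theorem1 (R : realType) (K : nat) (D0 B : R) (m v : 'I_K -> R)
    (rs : 'I_K -> R) (w r : nat -> 'I_K -> R) (eps : R) :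
  (0 < K)%N -> 0 < D0 -> 0 < B ->
  (forall k, 0 <= m k) -> (forall k, 0 <= v k) ->
  is_argmax_f (inG D0 B m v) rs ->
  w 0%N = @w_init R K ->
  (forall i, is_argmax_lin (inG D0 B m v) (w i) (r i)) ->
  0 < eps ->
  (forall i, eps <= `|dotv (w i) (vsub (r i) rs)| ->
             w i.+1 = w_next (w i) (r i) rs) ->
  exists i, `|dotv (w i) (vsub (r i) rs)| < eps.
Proof.
move=> K0 D0p Bp m0 v0 hrs w0 hr eps0 hstep.
apply/not_existsP => hno.
have [rsG rsp _] := hrs.
have s0 i : 0 <= dotv (w i) (vsub (r i) rs).
  by rewrite dotv_vsub subr_ge0; exact: (hr i).2.
have hge i : eps <= dotv (w i) (vsub (r i) rs).
  by rewrite -[X in _ <= X]ger0_norm // leNgt; apply/negP/hno.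
have sp i : 0 < dotv (w i) (vsub (r i) rs) by apply: lt_le_trans (hge i).
have wS i : w i.+1 = w_next (w i) (r i) rs by apply: hstep; rewrite ger0_norm.
have hw i : (forall k, 0 < w i k) /\ \sum_k w i k ^+ 2 = 1.
  elim: i => [|i [IH1 IH2]].
    have Kp : 0 < K%:R :> R by rewrite ltr0n.
    rewrite w0 /w_init; split=> [k|]; first by rewrite divr_gt0 // sqrtr_gt0.
    rewrite sumr_const card_ord exprMn expr1n mul1r exprVn sqr_sqrtr ?ltW //.
    by rewrite -[X in X = _]mulr_natl divff // lt0r_neq0.
  by rewrite wS; have [h1 [h2 _]] := w_next_step K0 IH1 IH2 (sp i).
have hs i := (w_next_step K0 (hw i).1 (hw i).2 (sp i)).2.2.
have [e he] := choice hs; have [nu hnu] := choice he.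
set c : R := D0 * B / ln 2; set sg : 'I_K -> R := fun k => Num.sqrt (v k).
have c0 : 0 < c := scale_gt0 D0p Bp.
have sg0 k : 0 <= sg k by exact: sqrtr_ge0.
have hpol i : exists pX : ('I_K -> R) * ('I_K -> 'I_K -> R), policy c m sg pX.1 pX.2 (r i).
  by have [p [X h]] := inG_policy D0p Bp v0 (hr i).1; exists (p, X).
have [pX hpX] := choice hpol.
have [ps [Xs hps]] := inG_policy D0p Bp v0 rsG.
set C := \sum_k c * (m k + sg k).
have Ck k : c * (m k + sg k) <= C.
  rewrite /C (bigD1 k) //= lerDl sumr_ge0 // => j _.
  by rewrite mulr_ge0 ?addr_ge0 // ltW.
have dC i k : `|vsub (r i) rs k| <= C.
  have h1 := policy_rate_le c0 m0 sg0 k (hpX i).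
  have h2 := policy_rate_le c0 m0 sg0 k hps.
  by rewrite /vsub ler_norml; have := Ck k; lra.
have pf p X r' : policy c m sg p X r' -> \sum_k r' k / rs k <= K%:R.
  by move=> h; apply: (argmax_f_le D0p Bp v0 hrs); exact: policy_inG h.
set g := fun k => (rs k)^-1.
have g0 k : 0 < g k by rewrite invr_gt0.
have gE r' : \sum_k g k * vsub r' rs k = \sum_k r' k / rs k - K%:R.
  rewrite -[in X in _ - X](card_ord K) -sumr_const -sumrB; apply: eq_bigr => k _.
  by rewrite /g /vsub mulrBr mulVf ?lt0r_neq0 // mulrC.
have [W [W0 [k0 Wk0] hW hesc]] := @traj_escape R K w (fun i => vsub (r i) rs) e nu g eps C
  (Ordinal K0) (fun i => (hw i).1) (fun i => (hw i).2) eps0 hge g0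
  (fun i => ltac:(by rewrite gE subr_le0; exact: pf (hpX i))) dC
  (fun i => ltac:(by have [] := hnu i)) (fun i => ltac:(by have [] := hnu i))
  (fun i k => ltac:(by rewrite wS; have [_ _ h _ _] := hnu i; exact: h))
  (fun i => ltac:(by have [] := hnu i)) (fun i => ltac:(by have [] := hnu i)).
have [phi hphi] := choice (fun n => ltac:(by have [i h1 h2] := hesc n; exists i; exact: (conj h1 h2))
  : exists i, (n <= i)%N /\ 0 <= \sum_(k | W k == 0) g k * vsub (r i) rs k).
(* [U] refines the filter of eventual sets and [phi n >= n], so the weights along [phi] still tend
   to [W]. *)
have [U [UU hU]] := ultraFilterLemma eventually_filter.
have UP : ProperFilter U := ultra_proper.
have [p [X [r' [hp' hr']]]] := @policy_ultralimit R K c m sg c0 m0 sg0 U UU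
  (fun n => (pX (phi n)).1) (fun n => r (phi n)) (fun n => (pX (phi n)).2) (fun n => hpX (phi n)).
have hWU k : (w (phi n) k @[n --> U] --> W k)%classic.
  apply/cvgrPdist_le => de de0; have [n hn] := hW k de de0.
  apply: hU; exists n => // i /= ni; rewrite distrC; apply: hn.
  exact: leq_trans ni (hphi i).1.
have hdr k : (vsub (r (phi n)) rs k @[n --> U] --> vsub r' rs k)%classic.
  by apply: cvgB => //; exact: cvg_cst.
have ho : optimal c m sg W r'.
  move=> p1 X1 r1 /(policy_inG D0p Bp v0) h1.
  apply: (@le_cvgU _ U _ (fun n => \sum_k w (phi n) k * r1 k) (fun n => \sum_k w (phi n) k * r (phi n) k)).
  - by apply: cvg_sumU => k; apply: cvgM => //; exact: cvg_cst.
  - by apply: cvg_sumU => k; apply: cvgM.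
  - by move=> n; exact: (hr (phi n)).2 _ h1.
have heps : eps <= \sum_k W k * vsub r' rs k.
  apply: (@le_cvgU _ U _ (fun=> eps) (fun n => \sum_k w (phi n) k * vsub (r (phi n)) rs k)).
  - exact: cvg_cst.
  - by apply: cvg_sumU => k; apply: cvgM.
  - by move=> n; exact: hge.
have hZ : 0 <= \sum_(k | W k == 0) g k * vsub r' rs k.
  apply: (@le_cvgU _ U _ (fun=> 0) (fun n => \sum_(k | W k == 0) g k * vsub (r (phi n)) rs k)).
  - exact: cvg_cst.
  - by apply: cvg_sumU => k; apply: cvgM => //; exact: cvg_cst.
  - by move=> n; exact: (hphi n).2.
have [j1 hj1] : exists j, 0 < W j * vsub r' rs j.
  apply/not_existsP => hn; have : \sum_k W k * vsub r' rs k <= 0; last by lra.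
  by rewrite -oppr_ge0 -sumrN sumr_ge0 // => k _; rewrite oppr_ge0 leNgt; apply/negP/hn.
have Wj1 : 0 < W j1.
  rewrite lt_neqAle W0 andbT eq_sym; apply: contraTneq hj1 => ->.
  by rewrite mul0r ltxx.
have dj1 : 0 < vsub r' rs j1 by rewrite -(pmulr_rgt0 _ Wj1).
(* With a second weighted user, all unweighted users fall strictly below their fair rates, against
   [hZ]. *)
have [[j2 [j12 Wj2]]|hn] := pselect (exists j2, j1 != j2 /\ 0 < W j2).
  have lt k : W k = 0 -> vsub r' rs k < 0.
    move=> Wk; rewrite /vsub subr_lt0.
    exact: (unweighted_rate_lt c0 m0 hps rsp pf hp' ho W0 j12 Wj1 Wj2 Wk).
  move: hZ; rewrite leNgt => /negP; apply.
  rewrite (bigD1 k0) /=; last by rewrite Wk0.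
  have h1 : g k0 * vsub r' rs k0 < 0 by rewrite pmulr_rlt0 // lt.
  have h2 : \sum_(k | (W k == 0) && (k != k0)) g k * vsub r' rs k <= 0.
    rewrite -oppr_ge0 -sumrN sumr_ge0 // => k /andP[/eqP Wk _].
    by rewrite oppr_ge0 pmulr_rle0 // ltW // lt.
  by lra.
(* Here the unweighted users are all users but [j1], so [hZ] and the gain of [j1] contradict
   proportional fairness. *)
have := pf _ _ _ hp'; rewrite -subr_le0 -gE (bigD1 j1) //=.
have -> : \sum_(k | k != j1) g k * vsub r' rs k = \sum_(k | W k == 0) g k * vsub r' rs k.
  apply: eq_bigl => k; apply/idP/eqP => [kj|Wk]; last first.
    by apply: contraTneq Wj1 => <-; rewrite Wk ltxx.
  apply/eqP/negPn/negP => Wk; apply: hn; exists k; split; first by rewrite eq_sym.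
  by rewrite lt_neqAle W0 andbT eq_sym.
have : 0 < g j1 * vsub r' rs j1 by rewrite mulr_gt0.
by lra.
Qed.
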